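(* Let $f:S\to\mathbb{R}$ be non-negative. Suppose that $\|\mathcal{I}_2(\theta_0)P_{\kappa4}(\theta_0)e_4\|_{e_2}<1$ and that there exists a non-negative function $v=(v(x):x\in\beta)$, with restrictions $v_3$ to $\tilde A$ and $v_4$ to $A^c$, such that $$P_{\beta\beta}(\theta_0)v\le v-f_\beta .$$ Then, entrywise, $$|\epsilon_i(f)|\le \mathcal{I}_i(\theta_0)P_{\kappa4}(\theta_0)v_4+\mathcal{I}_i(\theta_0)P_{\kappa4}(\theta_0)e_4\cdot m(f)\quad\text{for }i=2,3,$$ $$|\epsilon_4(f)|\le v_4+e_4\cdot m(f),$$ where $$m(f)=\frac{\big\|\mathcal{I}_2(\theta_0)P_{\kappa4}(\theta_0)v_4+\mathcal{I}_2(\theta_0)|f_\kappa|\big\|_{e_2}}{1-\|\mathcal{I}_2(\theta_0)P_{\kappa4}(\theta_0)e_4\|_{e_2}} .$$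
   Context: $S$ is a finite or countably infinite set, $P(\theta_0)=(P(\theta_0,x,y):x,y\in S)$ is the transition matrix of an irreducible recurrent Markov chain $X=(X_n:n\ge0)$, and $z\in S$ is fixed. $A\subseteq S$ is a finite set containing $z$, $A^c=S\setminus A$, $\Lambda=S\setminus\{z\}$, $\kappa=A\setminus\{z\}$, $K'\subseteq\kappa$, $\tilde A=\kappa\setminus K'$, and $\beta=\tilde A\cup A^c=\Lambda\setminus K'$. The indices $2,3,4$ refer to the sets $K',\tilde A,A^c$; for index sets, $P_{\kappa\kappa}(\theta_0)$, $P_{\Lambda\Lambda}(\theta_0)$, $P_{\beta\beta}(\theta_0)$, $P_{\kappa4}(\theta_0)$ denote the restrictions of $P(\theta_0)$ to $\kappa\times\kappa$, $\Lambda\times\Lambda$, $\beta\times\beta$, $\kappa\times A^c$, and $f_\kappa,f_\beta,f_\Lambda$ the restrictions of $f$ (as column vectors). $e_2$ and $e_4$ are the all-ones vectors on $K'$ and $A^c$. For $g$ on $K'$, $\|g\|_{e_2}=\max\{|g(x)|:x\in K'\}$. Values $+\infty$ of non-negative quantities are allowed, with $0\cdot\infty=0$. Absolute values and inequalities of vectors are entrywise. By irreducibility $\mathcal{I}_{\kappa\kappa}(\theta_0)=(I-P_{\kappa\kappa}(\theta_0))^{-1}=\sum_{n\ge0}P^n_{\kappa\kappa}(\theta_0)$ exists; $\mathcal{I}_2(\theta_0)$ and $\mathcal{I}_3(\theta_0)$ are its rows indexed by $K'$ and $\tilde A$ respectively (columns indexed by $\kappa$). Put $w_\Lambda(\theta_0,f)=\sum_{n=0}^\infty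 P_{\Lambda\Lambda}^n(\theta_0)f_\Lambda$, i.e. $w(\theta_0,x,f)=\mathbb{E}_x\sum_{j=0}^{\tau(z)-1}f(X_j)$ for $x\in\Lambda$, with $\tau(z)=\inf\{n\ge1:X_n=z\}$. Its truncation approximation $\underline{w}_\Lambda(\theta_0,f)$ equals $\mathcal{I}_{\kappa\kappa}(\theta_0)f_\kappa$ on $\kappa$ and $0$ on $A^c$. The error is $\epsilon_\Lambda(f)=w_\Lambda(\theta_0,f)-\underline{w}_\Lambda(\theta_0,f)$, with restrictions $\epsilon_2(f),\epsilon_3(f),\epsilon_4(f)$ to $K',\tilde A,A^c$. *)

(* Defs.v *)
From HB Require Import structures.
From mathcomp Require Import all_boot all_order all_algebra.
From mathcomp Require Import finmap all_classical all_reals.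
From mathcomp Require Import ereal topology normedtype sequences esum.

Set Implicit Arguments.
Unset Strict Implicit.
Unset Printing Implicit Defensive.

Import Order.TTheory GRing.Theory Num.Theory.
Local Open Scope classical_set_scope.
Local Open Scope ring_scope.
Local Open Scope ereal_scope.

(* Matrices and column vectors indexed by subsets of [S] are functions on all
   of [S], of which only the entries at the relevant indices are meaningful; the
   index set that is summed over is an explicit argument of each product.  All
   entries that occur are non-negative, so sums are taken in [\bar R] with
   [\esum], and [0 * +oo = 0] there. *)

Section Matrices.
Context {R : realType} {S : countType}.
Implicit Types (B : set S) (M N : S -> S -> \bar R) (g : S -> \bar R).

Definition mulmv B M g : S -> \bar R :=
  fun x => \esum_(y in B) (M x y * g y).

Definition mulmm B M N : S -> S -> \bar R :=
  fun x y => \esum_(u in B) (M x u * N u y).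

(* The [n]-th power of the restriction of [M] to [B x B]; for [x], [y] in [B]. *)
Fixpoint restr_pow B M (n : nat) : S -> S -> \bar R :=
  if n is n'.+1 then mulmm B M (restr_pow B M n')
  else fun x y => ((x == y)%:R)%:E.

End Matrices.

Section MarkovChains.
Context {R : realType} {S : countType}.
Variable P : S -> S -> R.

Definition kernel_of : S -> S -> \bar R := fun x y => (P x y)%:E.

Definition stochastic : Prop :=
  (forall x y, (0 <= P x y)%R) /\ (forall x, \esum_(y in setT) (P x y)%:E = 1).

Definition irreducible : Prop :=
  forall x y, exists n, 0 < restr_pow setT kernel_of n x y.

(* [first_passage n x y] is the probability, starting from [x], that the first
   time [k >= 1] with [X_k = y] is [k = n.+1]. *)
Fixpoint first_passage (n : nat) : S -> S -> \bar R :=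
  if n is n'.+1 then
    fun x y => \esum_(u in [set~ y]) ((P x u)%:E * first_passage n' u y)
  else fun x y => (P x y)%:E.

Definition recurrent : Prop :=
  forall x, \sum_(0 <= n <oo) first_passage n x x = 1.

End MarkovChains.

Section Truncation.
Context {R : realType} {S : countType}.
Variables (P : S -> S -> R) (z : S) (A K' : set S) (f : S -> R).

Definition Lambda : set S := [set~ z].
Definition kappa : set S := A `\ z.
Definition Atilde : set S := kappa `\` K'.
Definition beta : set S := Atilde `|` ~` A.

(* The inverse of the identity minus the restriction of [P] to [kappa], as a
   Neumann series.  Its rows indexed by [K'] and by [Atilde] are obtained by
   evaluating at [x] in [K'] and in [Atilde]. *)
Definition I_kappa : S -> S -> \bar R :=
  fun x y => \sum_(0 <= n <oo) restr_pow kappa (kernel_of P) n x y.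

Definition w : S -> \bar R := fun x =>
  \sum_(0 <= n <oo)
    mulmv Lambda (restr_pow Lambda (kernel_of P) n) (EFin \o f) x.

Definition w_trunc : S -> \bar R := fun x =>
  if x \in A then mulmv kappa I_kappa (EFin \o f) x else 0.

Definition err : S -> \bar R := fun x => w x - w_trunc x.

(* The vector [I_kappa P_(kappa,A^c) g] on [kappa], for [g] on the complement
   of [A]. *)
Definition IP4 (g : S -> \bar R) : S -> \bar R :=
  mulmv kappa I_kappa (mulmv (~` A) (kernel_of P) g).

Definition ones : S -> \bar R := fun=> 1.

(* Maximum of [|g|] over [K'], which is a finite set; it is [0] when [K'] is
   empty. *)
Definition maxnorm (g : S -> \bar R) : \bar R :=
  \big[maxe/0]_(x <- fset_set K') `|g x|.

Definition m (v : S -> \bar R) : \bar R :=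
  maxnorm (fun x => IP4 v x + mulmv kappa I_kappa (fun y => `|f y|%:E) x)
  / (1 - maxnorm (IP4 ones)).

End Truncation.

(* Main.v *)
(* Let W_k be the sum of the first k terms of the series defining w, so that
   W_(k+1) = f + P_(Lambda,Lambda) W_k.  On beta the drift condition makes
   v + m a supersolution of this recursion as long as W_k <= m on K'.  On kappa,
   solving the recursion for the entries in kappa gives
   W_(k+1) <= I_kappa (f + P_(kappa,4) (v + m)), which on K' is at most N + q m,
   where q and N are the norms in m = N / (1 - q); and N + q m <= m.  So the
   bounds W_k <= m on K' and W_k <= v + m on beta follow by a simultaneous
   induction on k starting from W_0 = 0, which never requires w to be finite.
   Letting k tend to infinity bounds w.  To subtract the truncation on kappa one
   needs I_kappa f < +oo: by irreducibility some power of P_(kappa,kappa) has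
   row sums bounded away from 1, because z lies outside the finite set kappa. *)

Require Import Defs.
From HB Require Import structures.
From mathcomp Require Import all_boot all_order all_algebra.
From mathcomp Require Import finmap all_classical all_reals.
From mathcomp Require Import ereal topology normedtype sequences esum.

Set Implicit Arguments.
Unset Strict Implicit.
Unset Printing Implicit Defensive.

Import Order.TTheory GRing.Theory Num.Theory.
Local Open Scope classical_set_scope.
Local Open Scope ring_scope.
Local Open Scope ereal_scope.

(** * Tonelli-type rules for sums of non-negative extended reals *)

Section Esum.
Context {R : realType}.

Lemma esum_swap (T1 T2 : choiceType) (I : set T1) (J : set T2)
    (a : T1 -> T2 -> \bar R) : (forall i j, I i -> J j -> 0 <= a i j) ->
  \esum_(i in I) \esum_(j in J) a i j = \esum_(j in J) \esum_(i in I) a i j.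
Proof.
move=> a0; rewrite !esum_esum//; last by move=> *; exact: a0.
rewrite (@reindex_esum R _ _ (J `*`` fun=> I) _ (fun x => (x.2, x.1)))//.
split=> [[i j] []//|[i j] [i' j'] _ _ [-> ->]//|[i j] [? ?]].
by exists (j, i).
Qed.

Lemma le_esum_subset (T : choiceType) (I J : set T) (a : T -> \bar R) :
  I `<=` J -> (forall j, J j -> 0 <= a j) ->
  \esum_(i in I) a i <= \esum_(j in J) a j.
Proof.
move=> IJ a0; rewrite [leRHS](esumID I)// (setIidr IJ) leeDl//.
by apply: esum_ge0 => j [/a0].
Qed.

(** Finite sums give one inequality for every [c]. For finite positive [c] the converse is that same
    inequality applied to the inverse of [c]; the values [0] and [+oo] are treated apart. *)
Lemma esumZr (T : choiceType) (I : set T) (a : T -> \bar R) (c : \bar R) :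
  (forall i, I i -> 0 <= a i) -> 0 <= c ->
  \esum_(i in I) (a i * c) = (\esum_(i in I) a i) * c.
Proof.
(* Extending [a] by zero outside [I] reduces to the full index type, since [0 * c = 0] even for
   [c = +oo]. *)
wlog -> : I a / I = setT => [main a0 c0|].
  rewrite esum_mkcond [in RHS]esum_mkcond.
  rewrite -(main setT (fun i => if i \in I then a i else 0))//; last first.
    by move=> i _; case: ifPn => // /[!inE]/a0.
  by apply: eq_esum => i _; case: ifPn; rewrite ?mul0e.
have esumZr_le (b : T -> \bar R) d : (forall i, 0 <= b i) -> 0 <= d ->
    \esum_(i in setT) (b i * d) <= (\esum_(i in setT) b i) * d.
  move=> b0 d0; apply: ge_ereal_sup => _ [X XI <-].
  rewrite -ge0_mule_fsuml//; apply: lee_wpmul2r => //.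
  by apply: ereal_sup_ubound; exists X.
move=> a0' c0; have a0 i : 0 <= a i by exact: a0'.
apply/eqP; rewrite eq_le esumZr_le//=.
have esum_ge i : a i * c <= \esum_(j in setT) (a j * c).
  rewrite -(@esum_set1 _ _ i (fun j => a j * c)) ?mule_ge0//.
  by apply: le_esum_subset => // j _; exact: mule_ge0.
have [->|cN0] := eqVneq c 0.
  by rewrite mule0 esum_ge0// => i; rewrite mule0.
have c_gt0 : 0 < c by rewrite lt0e cN0.
(* For [c = +oo], a single non-zero [a i] already makes the left-hand sum infinite; otherwise both
   sides vanish. *)
move: c cN0 c0 c_gt0 esum_ge => [r| |]// _ r0 r_gt0 esum_ge; last first.
  have [[i /eqP ai0]|/forallNP aN0] := pselect (exists i, a i <> 0).
    apply: le_trans (esum_ge i).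
    have ai_gt0 : 0 < a i by rewrite lt0e ai0 a0.
    by rewrite (gt0_muley ai_gt0) leey.
  rewrite [X in X * _]esum1 ?mul0e ?esum_ge0// => i _; first exact: mule_ge0.
  by apply: contrapT; exact: aN0.
rewrite -lee_pdivlMr//; apply: le_trans (esumZr_le _ _ _ _); last 2 first.
- by move=> i; exact: mule_ge0.
- by rewrite lee_fin invr_ge0.
by apply: le_esum => i _; rewrite -muleA -EFinM divff ?mule1// gt_eqF.
Qed.

Lemma esum_nneseries (T : choiceType) (I : set T) (a : T -> nat -> \bar R) :
  (forall i n, I i -> 0 <= a i n) ->
  \esum_(i in I) \sum_(0 <= n <oo) a i n =
  \sum_(0 <= n <oo) \esum_(i in I) a i n.
Proof.
move=> a0; rewrite nneseries_esumT => [|n]; last first.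
  by apply: esum_ge0 => i /a0.
rewrite -esum_swap => [|i n Ii _]; last exact: a0.
by apply: eq_esum => i Ii; rewrite nneseries_esumT// => n; exact: a0.
Qed.

End Esum.

(** * The maximum norm over a finite index set *)

Section Maxnorm.
Context {R : realType} {S : countType}.
Variable B : set S.
Hypothesis B_finite : finite_set B.
Implicit Types (g : S -> \bar R).

Lemma maxnorm_ge0 g : 0 <= maxnorm B g.
Proof.
by rewrite /maxnorm; elim/big_ind: _ => // x y x0 y0; rewrite le_max x0.
Qed.

Lemma le_maxnorm g x : B x -> g x <= maxnorm B g.
Proof.
move=> Bx; apply: le_trans (lee_abs _) _.
apply: (@le_bigmax_seq _ _ _ _ 0 x xpredT (fun y => `|g y|)) => //.
by rewrite in_fset_set// mem_set.
Qed.

(** Positivity of [c] covers the default value [0] of the maximum, which is attained when [B] is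
    empty. *)
Lemma maxnorm_lt g (c : \bar R) : 0 < c ->
  (forall x, B x -> `|g x| < c) -> maxnorm B g < c.
Proof.
move=> c0 gc; rewrite /maxnorm big_seq_cond.
elim/big_ind: _ => // [x y|x]; first by rewrite gt_max => -> ->.
by rewrite andbT in_fset_set// => /set_mem/gc.
Qed.

End Maxnorm.

(** * Non-negative matrices, restricted powers and partial sums of Neumann series *)

Section Potential.
Context {R : realType} {S : countType}.
Implicit Types (B : set S) (g h : S -> \bar R).

Definition potential B (M : S -> S -> \bar R) g (k : nat) : S -> \bar R :=
  fun x => \sum_(0 <= n < k) mulmv B (restr_pow B M n) g x.

Lemma eq_mulmv B (N : S -> S -> \bar R) g h x :
  (forall y, B y -> g y = h y) -> mulmv B N g x = mulmv B N h x.
Proof. by move=> gh; apply: eq_esum => y By; rewrite gh. Qed.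

Section NonnegativeMatrix.
Variable M : S -> S -> \bar R.
Hypothesis M_ge0 : forall x y, 0 <= M x y.

Lemma mulmv_ge0 B g x : (forall y, B y -> 0 <= g y) -> 0 <= mulmv B M g x.
Proof. by move=> g0; apply: esum_ge0 => y /g0; exact: mule_ge0. Qed.

Lemma le_mulmv B g h x :
  (forall y, B y -> g y <= h y) -> mulmv B M g x <= mulmv B M h x.
Proof. by move=> gh; apply: le_esum => y /gh; exact: lee_wpmul2l. Qed.

Lemma mulmvD B g h x :
  (forall y, B y -> 0 <= g y) -> (forall y, B y -> 0 <= h y) ->
  mulmv B M (fun y => g y + h y) x = mulmv B M g x + mulmv B M h x.
Proof.
move=> g0 h0; rewrite /mulmv -esumD; first last.
- by move=> y /h0; exact: mule_ge0.
- by move=> y /g0; exact: mule_ge0.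
by apply: eq_esum => y By; rewrite ge0_muleDr ?g0 ?h0.
Qed.

Lemma mulmvZ B g (c : \bar R) x : (forall y, B y -> 0 <= g y) -> 0 <= c ->
  mulmv B M (fun y => g y * c) x = mulmv B M g x * c.
Proof.
move=> g0 c0; rewrite /mulmv -esumZr// => [|y /g0]; last exact: mule_ge0.
by apply: eq_esum => y _; rewrite muleA.
Qed.

Lemma mulmv_cst B (c : \bar R) x : 0 <= c ->
  mulmv B M (cst c) x = mulmv B M (@ones R S) x * c.
Proof.
move=> c0; rewrite -mulmvZ//.
by apply: eq_mulmv => y _; rewrite /ones mul1e.
Qed.

Lemma mulmv_sum B (g : nat -> S -> \bar R) k x :
  (forall n y, B y -> 0 <= g n y) ->
  mulmv B M (fun y => \sum_(0 <= n < k) g n y) x =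
  \sum_(0 <= n < k) mulmv B M (g n) x.
Proof.
move=> g0; rewrite /mulmv -esum_sum => [|y n By _]; last first.
  by rewrite mule_ge0 ?g0.
by apply: eq_esum => y By; rewrite ge0_sume_distrr// => n _; exact: g0.
Qed.

Lemma mulmv_setU B1 B2 g x : [disjoint B1 & B2] ->
  (forall y, (B1 `|` B2) y -> 0 <= g y) ->
  mulmv (B1 `|` B2) M g x = mulmv B1 M g x + mulmv B2 M g x.
Proof.
move=> /disj_setPS B12 g0; rewrite /mulmv (esumID B1); last first.
  by move=> y /g0; exact: mule_ge0.
have -> : (B1 `|` B2) `&` B1 = B1 by rewrite setUK.
suff -> : (B1 `|` B2) `&` ~` B1 = B2 by [].
apply/seteqP; split=> [y [[]]//|y B2y]; split; [by right|move=> B1y].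
exact: (B12 y).
Qed.

Lemma mulmv_mulmm B (N : S -> S -> \bar R) g x :
  (forall y u, 0 <= N y u) -> (forall y, B y -> 0 <= g y) ->
  mulmv B (mulmm B M N) g x = mulmv B M (mulmv B N g) x.
Proof.
move=> N0 g0; rewrite /mulmv /mulmm.
transitivity (\esum_(y in B) \esum_(u in B) (M x u * N u y * g y)).
  by apply: eq_esum => y By; rewrite esumZr ?g0// => u _; exact: mule_ge0.
rewrite esum_swap => [|y u By _]; last by rewrite !mule_ge0 ?g0.
apply: eq_esum => u _; rewrite muleC -esumZr//; last first.
  by move=> y /g0; exact: mule_ge0.
by apply: eq_esum => y _; rewrite -muleA muleC.
Qed.

End NonnegativeMatrix.

Section RestrictedPowers.
Variable M : S -> S -> \bar R.
Hypothesis M_ge0 : forall x y, 0 <= M x y.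

Lemma restr_pow_ge0 B n x y : 0 <= restr_pow B M n x y.
Proof.
elim: n x => [|n IHn] x /=; first by rewrite lee_fin ler0n.
by apply: esum_ge0 => u _; exact: mule_ge0.
Qed.

(** A larger index set admits more paths. This compares [B] with the whole space, and later [kappa]
    with [Lambda]. *)
Lemma le_restr_pow B1 B2 n x y : B1 `<=` B2 ->
  restr_pow B1 M n x y <= restr_pow B2 M n x y.
Proof.
move=> B12; elim: n x => [//|n IHn] x /=.
apply: (@le_trans _ _ (mulmm B1 M (restr_pow B2 M n) x y)).
  by apply: le_esum => u _; exact: lee_wpmul2l.
by apply: le_esum_subset => // u _; rewrite mule_ge0 ?restr_pow_ge0.
Qed.

Lemma mulmv_restr_pow0 B g x : B x -> (forall y, B y -> 0 <= g y) ->
  mulmv B (restr_pow B M 0) g x = g x.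
Proof.
move=> Bx g0; rewrite /mulmv/= (esumID [set x]); last first.
  by move=> y /g0; apply: mule_ge0; rewrite lee_fin ler0n.
rewrite [X in _ + X]esum1 => [|y [_ /= /eqP]]; last first.
  by rewrite eq_sym => /negPf ->; rewrite mul0e.
rewrite setIidr => [|y -> //].
by rewrite esum_set1 eqxx mul1e ?adde0// g0.
Qed.

Lemma mulmv_restr_powS B n g x : (forall y, B y -> 0 <= g y) ->
  mulmv B (restr_pow B M n.+1) g x = mulmv B M (mulmv B (restr_pow B M n) g) x.
Proof. by move=> g0; rewrite /= mulmv_mulmm// => *; exact: restr_pow_ge0. Qed.

Section NonnegativeVector.
Variables (B : set S) (g : S -> \bar R).
Hypothesis g_ge0 : forall y, B y -> 0 <= g y.

Lemma mulmv_restr_pow_ge0 n x : 0 <= mulmv B (restr_pow B M n) g x.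
Proof.
by apply: esum_ge0 => y /g_ge0; apply: mule_ge0; exact: restr_pow_ge0.
Qed.

Lemma potential_ge0 k x : 0 <= potential B M g k x.
Proof. by apply: sume_ge0 => n _; exact: mulmv_restr_pow_ge0. Qed.

Lemma potential0 x : potential B M g 0 x = 0.
Proof. by rewrite /potential big_geq. Qed.

Lemma potentialS k x : B x ->
  potential B M g k.+1 x = g x + mulmv B M (potential B M g k) x.
Proof.
move=> Bx; rewrite /potential big_nat_recl// mulmv_restr_pow0//; congr (_ + _).
rewrite (mulmv_sum M_ge0) => [|n y _]; last exact: mulmv_restr_pow_ge0.
by apply: eq_bigr => n _; exact: mulmv_restr_powS.
Qed.

Lemma le_potential k l x : (k <= l)%N ->
  potential B M g k x <= potential B M g l x.
Proof.
move=> kl; rewrite /potential (big_cat_nat _ kl)//= leeDl//.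
by apply: sume_ge0 => n _; exact: mulmv_restr_pow_ge0.
Qed.

Lemma potentialD n k x : B x ->
  potential B M g (n + k) x =
  potential B M g n x + mulmv B (restr_pow B M n) (potential B M g k) x.
Proof.
elim: n x => [|n IHn] x Bx.
  by rewrite potential0 add0e mulmv_restr_pow0// => y _; exact: potential_ge0.
rewrite addSn !potentialS// mulmv_restr_powS; last first.
  by move=> y _; exact: potential_ge0.
rewrite -addeA -(mulmvD M_ge0); first last.
- move=> y _; apply: esum_ge0 => u _.
  by rewrite mule_ge0 ?restr_pow_ge0 ?potential_ge0.
- by move=> y _; exact: potential_ge0.
by congr (_ + _); apply: eq_mulmv.
Qed.

Lemma potential_le_series k x :
  potential B M g k x <= \sum_(0 <= n <oo) mulmv B (restr_pow B M n) g x.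
Proof. by apply: nneseries_lim_ge => n _ _; exact: mulmv_restr_pow_ge0. Qed.

Lemma series_le_potential (c : \bar R) x :
  (forall k, potential B M g k x <= c) ->
  \sum_(0 <= n <oo) mulmv B (restr_pow B M n) g x <= c.
Proof.
move=> gc; apply: lime_le; last by apply: nearW => k; exact: gc.
by apply: is_cvg_nneseries => n _ _; exact: mulmv_restr_pow_ge0.
Qed.

(** By Tonelli, the Neumann series can be applied to [g] term by term; this links [I_kappa] to the
    limit of [potential]. *)
Lemma mulmv_series x :
  mulmv B (fun y u => \sum_(0 <= n <oo) restr_pow B M n y u) g x =
  \sum_(0 <= n <oo) mulmv B (restr_pow B M n) g x.
Proof.
rewrite /mulmv -esum_nneseries => [|y n By]; last first.
  by rewrite mule_ge0 ?restr_pow_ge0 ?g_ge0.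
apply: eq_esum => y By; rewrite !nneseries_esumT; first last.
- by move=> n; exact: restr_pow_ge0.
- by move=> n; rewrite mule_ge0 ?restr_pow_ge0 ?g_ge0.
by rewrite esumZr ?g_ge0// => n _; exact: restr_pow_ge0.
Qed.

(* If the n-th power has row sums at most [rho] then
   [potential k <= potential (n + k) = potential n + M^n (potential k)], so a
   uniform bound [c >= potential n + c * rho] is preserved. *)
Lemma potential_bounded n (rho c : R) : (0 < n)%N -> (0 <= c)%R ->
  (forall x, B x -> mulmv B (restr_pow B M n) (@ones R S) x <= rho%:E) ->
  (forall x, B x -> potential B M g n x + (rho * c)%:E <= c%:E) ->
  forall k x, B x -> potential B M g k x <= c%:E.
Proof.
move=> n0 c0 rhoP cP; elim=> [|k IHk] x Bx; first by rewrite potential0 lee_fin.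
apply: le_trans (@le_potential _ (n + k) x _) _.
  by rewrite -addn1 addnC leq_add2r.
rewrite potentialD//; apply: le_trans (cP x Bx); apply: leeD => //.
have pow0 := restr_pow_ge0 B n.
apply: (@le_trans _ _ (mulmv B (restr_pow B M n) (cst c%:E) x)).
  by apply: le_esum => y /IHk; exact: lee_wpmul2l.
rewrite (mulmv_cst pow0)// EFinM; apply: lee_wpmul2r; rewrite ?lee_fin//.
exact: rhoP.
Qed.

End NonnegativeVector.

Lemma mulmv_ones_le1 B n x : (forall y, B y -> mulmv B M (@ones R S) y <= 1) ->
  B x -> mulmv B (restr_pow B M n) (@ones R S) x <= 1.
Proof.
have ones0 (y : S) : B y -> 0 <= @ones R S y by rewrite lee_fin.
move=> M1; elim: n x => [|n IHn] x Bx; first by rewrite mulmv_restr_pow0.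
rewrite mulmv_restr_powS//; apply: le_trans (M1 x Bx).
exact: le_mulmv.
Qed.

(** A substochastic restriction can only lose mass over time, so bounds obtained at different
    exponents carry over to any larger common exponent. *)
Lemma mulmv_restr_pow_ones_anti B n k x :
  (forall y, B y -> mulmv B M (@ones R S) y <= 1) -> B x -> (n <= k)%N ->
  mulmv B (restr_pow B M k) (@ones R S) x <=
  mulmv B (restr_pow B M n) (@ones R S) x.
Proof.
have ones0 (y : S) : B y -> 0 <= @ones R S y by rewrite lee_fin.
move=> M1 Bx /subnK <-; elim: (k - n)%N => [//|l IHl].
(* It remains to compare consecutive powers: the base case is the row sum bound, and multiplying by
   [M] on the left preserves the inequality. *)
apply: le_trans IHl; rewrite addSn; elim: (l + n)%N x Bx => [|j IHj] x Bx.
  by apply: le_trans (mulmv_ones_le1 1 M1 Bx) _; rewrite mulmv_restr_pow0.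
rewrite mulmv_restr_powS// [leRHS]mulmv_restr_powS//.
exact: le_mulmv.
Qed.

Lemma potential_le_cst B (c : R) k x : (0 <= c)%R ->
  (forall y, B y -> mulmv B M (@ones R S) y <= 1) -> B x ->
  potential B M (cst c%:E) k x <= (c *+ k)%:E.
Proof.
move=> c0 M1; elim: k x => [|k IHk] x Bx; first by rewrite potential0.
rewrite potentialS// mulrS EFinD leeD//.
apply: (@le_trans _ _ (mulmv B M (cst (c *+ k)%:E) x)).
  exact: le_mulmv.
rewrite mulmv_cst ?lee_fin ?mulrn_wge0//.
rewrite -[leRHS]mul1e; apply: lee_wpmul2r; rewrite ?lee_fin ?mulrn_wge0//.
exact: M1.
Qed.

Lemma potential_mono B g h k x : (forall y, B y -> 0 <= g y) ->
  (forall y, B y -> g y <= h y) -> potential B M g k x <= potential B M h k x.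
Proof.
move=> g0 gh; apply: lee_sum => n _; apply: le_esum => y By.
by apply: lee_wpmul2l; [exact: restr_pow_ge0|exact: gh].
Qed.

End RestrictedPowers.
End Potential.

(** * Finiteness of the potential on a finite set that misses a state *)

Section IrreducibleChain.
Context {R : realType} {S : countType}.
Variable P : S -> S -> R.
Hypothesis P_stochastic : stochastic P.
Implicit Types (B : set S).

Lemma kernel_of_ge0 x y : 0 <= kernel_of P x y.
Proof. by rewrite lee_fin; case: P_stochastic. Qed.

Lemma mulmv_kernel_setT x : mulmv setT (kernel_of P) (@ones R S) x = 1.
Proof.
rewrite -[RHS](P_stochastic.2 x).
by apply: eq_esum => y _; rewrite /ones mule1.
Qed.

Lemma mulmv_kernel_le1 B x : mulmv B (kernel_of P) (@ones R S) x <= 1.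
Proof.
rewrite -(mulmv_kernel_setT x); apply: le_esum_subset => // y _.
by rewrite mule_ge0 ?kernel_of_ge0 ?lee_fin.
Qed.

Hypothesis P_irreducible : irreducible P.

(** Irreducibility gives an [n] for which the chain started at [x] is at [z] after [n] steps with
    positive probability; paths staying in [B] cannot account for that mass. *)
Lemma mulmv_restr_pow_ones_lt1 B z x : ~ B z ->
  exists n, mulmv B (restr_pow B (kernel_of P) n) (@ones R S) x < 1.
Proof.
move=> Bz; have [n pn_gt0] := P_irreducible x z; exists n.
have pow0 C i u y := @restr_pow_ge0 R S (kernel_of P) kernel_of_ge0 C i u y.
have : mulmv B (restr_pow B (kernel_of P) n) (@ones R S) x
    + restr_pow setT (kernel_of P) n x z <= 1.
  apply: le_trans (@mulmv_ones_le1 _ _ _ kernel_of_ge0 setT n x _ _) => //;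
    last by move=> y _; exact: mulmv_kernel_le1.
  rewrite /mulmv [leRHS](esumID [set z]) => [|y _]; last first.
    by rewrite mule_ge0 ?lee_fin.
  (* Once the entry at [z] is split off the full row sum, the remaining entries dominate those in
     [B], because [z] is outside [B]. *)
  rewrite !setTI esum_set1 ?mule_ge0 ?lee_fin// [leLHS]addeC.
  apply: leeD; first by rewrite /ones mule1.
  apply: (@le_trans _ _ (\esum_(y in B)
      restr_pow setT (kernel_of P) n x y * @ones R S y)).
    apply: le_esum => y _; rewrite !mule1 le_restr_pow//.
    exact: kernel_of_ge0.
  apply: le_esum_subset => [y By /= yz|y _]; first by apply: Bz; rewrite -yz.
  by rewrite mule_ge0 ?lee_fin.
move=> le1; rewrite lt_neqAle (le_trans _ le1) ?leeDl ?pow0// andbT.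
apply: contraTneq le1 => ->; rewrite -ltNge -[ltLHS]adde0.
by rewrite lteD2lE.
Qed.

Lemma uniform_mulmv_restr_pow_ones_lt1 B z : finite_set B -> ~ B z ->
  exists n (rho : R), [/\ (0 < n)%N, (0 <= rho)%R, (rho < 1)%R &
    forall x, B x -> mulmv B (restr_pow B (kernel_of P) n) (@ones R S) x <= rho%:E].
Proof.
move=> Bfin Bz.
have [n nP] := choice (fun x => @mulmv_restr_pow_ones_lt1 B z x Bz).
(* The successor makes the common exponent positive, even if every [n x] is [0] or [B] is empty. *)
pose N := (\max_(x <- fset_set B) n x).+1.
pose r := mulmv B (restr_pow B (kernel_of P) N) (@ones R S).
have r_lt1 : maxnorm B r < 1.
  apply: maxnorm_lt => // x Bx; rewrite gee0_abs; last first.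
    by apply: esum_ge0 => y _; rewrite mule_ge0 ?lee_fin ?restr_pow_ge0//;
      exact: kernel_of_ge0.
  apply: le_lt_trans (nP x); apply: mulmv_restr_pow_ones_anti => //.
  - exact: kernel_of_ge0.
  - by move=> y _; exact: mulmv_kernel_le1.
  - by apply/leqW/leq_bigmax_seq => //; rewrite in_fset_set// mem_set.
have r_fin : maxnorm B r \is a fin_num.
  by rewrite ge0_fin_numE ?maxnorm_ge0// (lt_trans r_lt1) ?ltry.
exists N, (fine (maxnorm B r)); split=> //.
- by rewrite fine_ge0 ?maxnorm_ge0.
- by rewrite -lte_fin fineK.
- by move=> x Bx; rewrite fineK//; exact: le_maxnorm.
Qed.

(** On the finite set [B], [f] is at most a constant [F], and the geometric decay of the row sums
    bounds all partial sums by one constant. *)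
Lemma series_restr_pow_lty B z (f : S -> R) x : finite_set B -> ~ B z ->
  (forall y, (0 <= f y)%R) -> B x ->
  \sum_(0 <= n <oo)
    mulmv B (restr_pow B (kernel_of P) n) (EFin \o f) x < +oo.
Proof.
move=> Bfin Bz f0 Bx.
have [n [rho [n0 rho0 rho1 rhoP]]] := uniform_mulmv_restr_pow_ones_lt1 Bfin Bz.
have f0' y : B y -> 0 <= (EFin \o f) y by rewrite lee_fin.
pose F : R := \big[Num.max/0%R]_(y <- fset_set B) f y.
have F0 : (0 <= F)%R.
  by rewrite /F; elim/big_ind: _ => // a b a0 b0; rewrite le_max a0.
have fF y : B y -> (EFin \o f) y <= (cst F%:E : S -> \bar R) y.
  move=> By; rewrite lee_fin; apply: le_bigmax_seq => //.
  by rewrite in_fset_set// mem_set.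
have rho1' : (0 < 1 - rho)%R by rewrite subr_gt0.
(* This is the solution of [F *+ n + rho * c = c], where [F *+ n] bounds the first [n] terms of the
   series. *)
pose c := (F *+ n / (1 - rho))%R.
have c0 : (0 <= c)%R by rewrite divr_ge0 ?mulrn_wge0// ltW.
apply: (@le_lt_trans _ _ c%:E); last exact: ltry.
apply: series_le_potential => //; first exact: kernel_of_ge0.
move=> k; apply: (potential_bounded kernel_of_ge0 f0' n0 c0 rhoP) => // y By.
apply: (@le_trans _ _ ((F *+ n)%:E + (rho * c)%:E)).
  apply: leeD => //.
  apply: le_trans (potential_mono kernel_of_ge0 _ _ f0' fF) _.
  apply: potential_le_cst => //; first exact: kernel_of_ge0.
  by move=> u _; exact: mulmv_kernel_le1.
have -> : (F *+ n = (1 - rho) * c)%R by rewrite mulrC divfK// gt_eqF.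
by rewrite -EFinD lee_fin mulrBl mul1r subrK.
Qed.

End IrreducibleChain.

(** * The bounds on [w] and on the truncation error *)

Section TruncationError.
Context {R : realType} {S : countType}.
Variables (P : S -> S -> R) (z : S) (A K' : set S) (f : S -> R).
Variable v : S -> \bar R.
Hypotheses (P_stochastic : stochastic P) (P_irreducible : irreducible P).
Hypotheses (A_finite : finite_set A) (A_z : A z) (K'_kappa : K' `<=` kappa z A).
Hypothesis f_ge0 : forall x, (0 <= f x)%R.
Hypothesis norm_lt1 : maxnorm K' (IP4 P z A (@ones R S)) < 1.
Hypothesis v_ge0 : forall x, beta z A K' x -> 0 <= v x.
Hypothesis v_drift : forall x, beta z A K' x ->
  mulmv (beta z A K') (kernel_of P) v x <= v x - (f x)%:E.

Local Notation M := (kernel_of P).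
Local Notation kap := (kappa z A).
Local Notation mm := (m P z A K' f v).

Let M_ge0 : forall x y, 0 <= M x y. Proof. exact: kernel_of_ge0. Qed.

Let ones_ge0 (B : set S) y : B y -> 0 <= @ones R S y.
Proof. by rewrite lee_fin. Qed.

Let f_ge0E (B : set S) y : B y -> 0 <= (EFin \o f) y.
Proof. by rewrite lee_fin. Qed.

Lemma I_kappa_ge0 x y : 0 <= I_kappa P z A x y.
Proof. by apply: nneseries_ge0 => n _ _; exact: restr_pow_ge0. Qed.

Let kappa_z : ~ kap z. Proof. by case=> _; apply. Qed.

Let K'_finite : finite_set K'.
Proof. by apply: sub_finite_set K'_kappa _; exact: finite_setD. Qed.

Lemma setC_beta y : (~` A) y -> beta z A K' y. Proof. by right. Qed.

Lemma Lambda_kappa : Lambda z = kap `|` ~` A.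
Proof.
apply/seteqP; split=> y /= yz.
  by have [Ay|] := pselect (A y); [left|right].
by case: yz => [[]//|nAy yz]; apply: nAy; rewrite yz.
Qed.

Lemma Lambda_K' : Lambda z = K' `|` beta z A K'.
Proof.
rewrite Lambda_kappa /beta /Atilde setUA; congr (_ `|` _).
by rewrite setDUK.
Qed.

Let q := maxnorm K' (IP4 P z A (@ones R S)).

Let q_ge0 : 0 <= q. Proof. exact: maxnorm_ge0. Qed.

Let q_fin : q \is a fin_num.
Proof. by rewrite ge0_fin_numE// (lt_trans norm_lt1) ?ltry. Qed.

Lemma m_ge0 : 0 <= mm.
Proof.
by rewrite /m mule_ge0 ?maxnorm_ge0// inve_ge0 sube_ge0 ?q_fin// ltW.
Qed.

(** For finite [N] this is an equality, the quotient being the fixed point of [c = N + q * c]; for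
    [N = +oo] the right-hand side is [+oo]. *)
Lemma add_mul_div_le (N : \bar R) :
  0 <= N -> N + q * (N / (1 - q)) <= N / (1 - q).
Proof.
move=> N0; rewrite -(fineK q_fin) -EFinB.
have q1 : (0 < 1 - fine q)%R by rewrite subr_gt0 -lte_fin fineK.
rewrite inver gt_eqF//; case: N N0 => [r| |]// r0.
  rewrite -!EFinM -EFinD lee_fin; set c := (r / _)%R.
  have -> : r = ((1 - fine q) * c)%R by rewrite /c mulrC divfK// gt_eqF.
  by rewrite mulrBl mul1r subrK.
by rewrite gt0_mulye ?leey// lte_fin invr_gt0.
Qed.

(** The first two terms are at most the numerator [N] of [m], as [f] equals its absolute value, and
    the coefficient of [mm] is at most [q]; so the claim reduces to [N + q * mm <= mm]. *)
Lemma m_fixpoint x : K' x ->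
  mulmv kap (I_kappa P z A) (EFin \o f) x + IP4 P z A v x
    + IP4 P z A (@ones R S) x * mm <= mm.
Proof.
move=> K'x; apply: le_trans (add_mul_div_le (maxnorm_ge0 _ _)).
apply: leeD; last by apply: lee_wpmul2r; [exact: m_ge0|exact: le_maxnorm].
rewrite addeC; apply: le_trans (le_maxnorm K'_finite _ K'x).
by apply: leeD => //; apply: le_esum => y _; rewrite /= ger0_norm.
Qed.

Lemma IP4_shift x :
  IP4 P z A (fun y => v y + mm) x =
  IP4 P z A v x + IP4 P z A (@ones R S) x * mm.
Proof.
have v0 y : (~` A) y -> 0 <= v y by move/setC_beta/v_ge0.
have I0 := I_kappa_ge0.
transitivity (mulmv kap (I_kappa P z A) (fun y => mulmv (~` A) M v y +
    mulmv (~` A) M (@ones R S) y * mm) x).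
  apply: eq_mulmv => y _; rewrite mulmvD//; last by move=> *; exact: m_ge0.
  by rewrite -/(cst mm) mulmv_cst ?m_ge0.
rewrite mulmvD//; first last.
- move=> y _; rewrite mule_ge0 ?m_ge0//.
  by apply: mulmv_ge0 => // u; exact: ones_ge0.
- by move=> y _; exact: mulmv_ge0.
by rewrite mulmvZ ?m_ge0// => y _; apply: mulmv_ge0 => // u; exact: ones_ge0.
Qed.

(** The source term of the recursion on [kappa] once the entries in the complement of [A] are
    replaced by their bound [v + mm]. *)
Let g y := (f y)%:E + mulmv (~` A) M (fun u => v u + mm) y.

Let g_ge0 y : kap y -> 0 <= g y.
Proof.
move=> _; rewrite adde_ge0 ?lee_fin//.
apply: mulmv_ge0 => // u /setC_beta/v_ge0 v0.
by rewrite adde_ge0 ?m_ge0.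
Qed.

(** Partial sums are at most the full series [I_kappa] applied to [g], which linearity expands. The
    bound is independent of [k], so it survives the induction. *)
Lemma potential_kappa_le k x :
  potential kap M g k x <= mulmv kap (I_kappa P z A) (EFin \o f) x +
    (IP4 P z A v x + IP4 P z A (@ones R S) x * mm).
Proof.
rewrite -IP4_shift; apply: le_trans (potential_le_series M_ge0 g_ge0 k x) _.
rewrite -mulmv_series//.
rewrite -[X in X <= _]/(mulmv kap (I_kappa P z A) g x) mulmvD//.
- exact: I_kappa_ge0.
- by move=> y; exact: f_ge0E.
- move=> y _; apply: mulmv_ge0 => // u /setC_beta/v_ge0 v0.
  by rewrite adde_ge0 ?m_ge0.
Qed.

Let W := potential (Lambda z) M (EFin \o f).

(* The three bounds have to be propagated together: the bound on [kappa] uses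
   the one on the complement of [A], the bound by [m] on [K'] comes from the one
   on [kappa], and the bound on [beta] uses the one on [K']. *)
Lemma potential_Lambda_le k :
  [/\ forall x, kap x -> W k x <= potential kap M g k x,
      forall x, K' x -> W k x <= mm
    & forall x, beta z A K' x -> W k x <= v x + mm].
Proof.
have Lf := @f_ge0E (Lambda z).
have W0 i x : 0 <= W i x by exact: potential_ge0.
elim: k => [|k [IHk IHK' IHb]].
  split=> x xB; rewrite /W potential0 ?m_ge0// ?adde_ge0 ?v_ge0 ?m_ge0//.
  exact: potential_ge0.
(* One step from [kappa] lands either in [kappa], where [IHk] applies, or in the complement of [A],
   where [IHb] bounds [W] by the part built into [g]. *)
have kapS x : kap x -> W k.+1 x <= potential kap M g k.+1 x.
  move=> kx; have Lx : Lambda z x by rewrite Lambda_kappa; left.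
  rewrite /W potentialS// [leRHS]potentialS// -/W /g -addeA; apply: leeD => //.
  rewrite Lambda_kappa mulmv_setU//; last first.
    by apply/disj_setPS => y [[]].
  rewrite addeC; apply: leeD; apply: le_mulmv => // y Ay.
  exact/IHb/setC_beta.
split=> // [x K'x|x bx].
  apply: le_trans (kapS x (K'_kappa K'x)) _.
  by apply: le_trans (potential_kappa_le _ _) _; rewrite addeA m_fixpoint.
have Lx : Lambda z x by rewrite Lambda_K'; right.
rewrite /W potentialS// -/W.
have K'b : [disjoint K' & beta z A K'].
  apply/disj_setPS => y [K'y [[]|]]//; apply.
  by have [] := K'_kappa K'y.
(* On [beta], the copies of [mm] coming from [K'] and from [beta] combine into a row sum over
   [Lambda], which is at most [1]. *)
apply: (@le_trans _ _ ((f x)%:E + (mulmv (beta z A K') M v x + mm))).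
  apply: leeD => //.
  apply: (@le_trans _ _ (mulmv K' M (cst mm) x +
      mulmv (beta z A K') M (fun y => v y + mm) x)).
    rewrite Lambda_K' mulmv_setU//; apply: leeD; exact: le_mulmv.
  rewrite mulmvD//; last by move=> *; exact: m_ge0.
  rewrite addeCA leeD2l// -mulmv_setU//; last by move=> *; exact: m_ge0.
  rewrite mulmv_cst ?m_ge0// -[leRHS]mul1e.
  apply: lee_wpmul2r; first exact: m_ge0.
  exact: mulmv_kernel_le1.
(* What remains is the drift condition, with the finite term [f x] moved across. *)
rewrite addeA leeD2r// addeC.
by rewrite -leeBrDr// v_drift.
Qed.

Lemma w_le_of_potential x c : (forall k, W k x <= c) -> w P z f x <= c.
Proof. by move=> Wc; apply: series_le_potential => // y; exact: f_ge0E. Qed.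

Lemma w_le_beta x : beta z A K' x -> w P z f x <= v x + mm.
Proof.
move=> bx; apply: w_le_of_potential => k.
by have [_ _] := potential_Lambda_le k; exact.
Qed.

Lemma err_kappa_le x : kap x ->
  `|err P z A f x| <= IP4 P z A v x + IP4 P z A (@ones R S) x * mm.
Proof.
move=> kx; have Ax : x \in A by rewrite inE; case: kx.
rewrite /err /w_trunc Ax.
have kf := @f_ge0E kap.
set If := mulmv _ _ _ _.
have IfE : If = \sum_(0 <= n <oo) mulmv kap (restr_pow kap M n) (EFin \o f) x.
  exact: mulmv_series.
have If_fin : If \is a fin_num.
  rewrite ge0_fin_numE; last by apply: mulmv_ge0 => //; exact: I_kappa_ge0.
  rewrite IfE; apply: (series_restr_pow_lty _ _ _ kappa_z) => //.
  exact: finite_setD.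
have If_le : If <= w P z f x.
  rewrite IfE; apply: lee_nneseries => [n _ _|n _].
    exact: mulmv_restr_pow_ge0.
  apply: (@le_trans _ _ (mulmv kap (restr_pow (Lambda z) M n) (EFin \o f) x)).
    apply: le_esum => y _; apply: lee_wpmul2r; rewrite ?lee_fin//.
    by apply: le_restr_pow => //; rewrite Lambda_kappa; exact: subsetUl.
  apply: le_esum_subset => [|y _].
    by rewrite Lambda_kappa; exact: subsetUl.
  by rewrite mule_ge0 ?lee_fin ?restr_pow_ge0.
rewrite gee0_abs ?sube_ge0 ?If_fin// leeBlDl//.
apply: w_le_of_potential => k; have [+ _ _] := potential_Lambda_le k.
by move=> /(_ x kx)/le_trans; apply; exact: potential_kappa_le.
Qed.

End TruncationError.

Theorem proposition2 (R : realType) (S : countType) (P : S -> S -> R)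
    (z : S) (A K' : set S) (f : S -> R) (v : S -> \bar R)
    (P_stochastic : stochastic P)
    (P_irreducible : irreducible P)
    (P_recurrent : recurrent P)
    (A_finite : finite_set A)
    (A_z : A z)
    (K'_kappa : K' `<=` kappa z A)
    (f_ge0 : forall x, (0 <= f x)%R)
    (norm_lt1 : maxnorm K' (IP4 P z A (@ones R S)) < 1)
    (v_ge0 : forall x, beta z A K' x -> 0 <= v x)
    (v_drift : forall x, beta z A K' x ->
       mulmv (beta z A K') (kernel_of P) v x <= v x - (f x)%:E) :
  [/\ forall x, K' x ->
        `|err P z A f x| <=
          IP4 P z A v x + IP4 P z A (@ones R S) x * m P z A K' f v,
      forall x, Atilde z A K' x ->
        `|err P z A f x| <=
          IP4 P z A v x + IP4 P z A (@ones R S) x * m P z A K' f v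
    & forall x, (~` A) x ->
        `|err P z A f x| <= v x + ones x * m P z A K' f v].
Proof.
(* Both [K'] and [Atilde] lie in [kappa], where one bound serves for both. *)
split=> [x /K'_kappa|x []|x Ax]; try by move=> *; exact: err_kappa_le.
(* Off [A] the truncation vanishes, so the error is [w] itself. *)
rewrite /err /w_trunc ifF; last by apply/negP => /[!inE].
rewrite sube0 mul1e gee0_abs.
  by apply: w_le_beta => //; right.
by apply: nneseries_ge0 => n _ _; apply: mulmv_restr_pow_ge0 => *;
  rewrite ?lee_fin//; exact: kernel_of_ge0.
Qed.
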